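(* For all integers $n \ge 4$ we have, as $q\to+\infty$ over prime powers, $$w_2(q,n,n-2) \sim \left( \frac{1}{8}n^4-\frac{3}{4}n^3+\frac{19}{8}n^2-\frac{11}{4}n \right) q^{2n-6}.$$ In particular, the upper bound $|w_i(q,n,d)|\in O\bigl(q^{d-1+n(i-1)-\binom{i+1}{2}}\bigr)$ (valid for $d\ge 2$, $n\ge d+2$, $2\le i\le n$) is sharp for all $n\ge 4$ when $d=n-2$ and $i=2$, i.e. in this case $|w_i(q,n,d)|$ has exact order of growth $q^{d-1+n(i-1)-\binom{i+1}{2}}=q^{2n-6}$.
   Context: Let $q$ be a prime power. The Hamming weight of $v \in \mathbb{F}_q^n$ is the number of its nonzero coordinates. For integers $n,d\ge 1$, the higher-weight Dowling lattice $\mathcal{H}(q,n,d)$ is the set, ordered by inclusion, of all $\mathbb{F}_q$-linear subspaces of $\mathbb{F}_q^n$ that have a basis made of vectors of Hamming weight at most $d$, together with the zero space. It is a finite geometric lattice whose rank function is the $\mathbb{F}_q$-dimension. With $\mu$ the Möbius function of $\mathcal{H}(q,n,d)$, the $i$-th Whitney number (of the first kind) is $w_i(q,n,d)=\sum_{U \in \mathcal{H}(q,n,d),\ \dim U=i} \mu(\{0\},U)$. In the asymptotic estimates the parameters $n,d,i$ are fixed constants. *)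

(* Defs.v *)
From HB Require Import structures.
From mathcomp Require Import all_boot all_order all_algebra all_field.
From mathcomp Require Import boolp classical_sets reals topology normedtype.
From mathcomp Require Import landau.

Set Implicit Arguments.
Unset Strict Implicit.
Unset Printing Implicit Defensive.

Import Order.TTheory GRing.Theory Num.Theory.
Import numFieldNormedType.Exports.

Local Open Scope ring_scope.

Section Mobius.
Context {disp : Order.disp_t} {T : finPOrderType disp}.
Implicit Types x y z : T.

(* [k] bounds the recursion depth; [#|T|] suffices, since the interval
   [x, z] shrinks at each step (see [mobiusE]). *)
Fixpoint mobius_rec (k : nat) x y : int :=
  if k is k'.+1 then
    (x == y)%:R - \sum_(z : T | (x <= z)%O && (z < y)%O) mobius_rec k' x z
  else 0.

Definition mobius x y : int := mobius_rec #|T| x y.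

Lemma mobius_rec_stable k x y :
  (#|[set z : T | (z <= y)%O]| <= k)%N -> mobius_rec k x y = mobius x y.
Proof.
have stable k1 : forall k2 u v,
    (#|[set z : T | (z <= v)%O]| <= k1)%N ->
    (#|[set z : T | (z <= v)%O]| <= k2)%N ->
  mobius_rec k1 u v = mobius_rec k2 u v.
  have card_gt0 v : (0 < #|[set z : T | (z <= v)%O]|)%N.
    by rewrite (cardD1 v) inE lexx.
  elim: k1 => [|k1 IH] [|k2] u v h1 h2.
  - by [].
  - by have := leq_trans (card_gt0 v) h1.
  - by have := leq_trans (card_gt0 v) h2.
  congr (_ - _); apply: eq_bigr => z /andP[_ zv].
  have lt_card : (#|[set t : T | (t <= z)%O]| < #|[set t : T | (t <= v)%O]|)%N.
    apply: proper_card; apply/fintype.properP; split.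
      by apply/fintype.subsetP => t; rewrite !inE => /le_trans; apply; apply: ltW.
    by exists v; rewrite !inE ?lexx ?(lt_geF zv).
  by apply: IH; rewrite -ltnS; apply: leq_trans lt_card _.
by move=> h; apply: stable => //; apply: max_card.
Qed.

Lemma mobiusE x y :
  mobius x y = (x == y)%:R - \sum_(z : T | (x <= z)%O && (z < y)%O) mobius x z.
Proof.
rewrite -(@mobius_rec_stable #|T|.+1 x y); last by rewrite leqW// max_card.
by [].
Qed.

End Mobius.

(* The [subType] instance of [{vspace vT}] lives in an internal module. *)
Import VectorInternalTheory.

HB.instance Definition _ (F : finFieldType) (vT : vectType F) :=
  [Finite of {vspace vT} by <:].

Fact vspace_display : Order.disp_t. Proof. exact: Order.Disp tt tt. Qed.

Section VspaceOrder.
Context {F : fieldType} {vT : vectType F}.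

Lemma subv_antisym : antisymmetric (fun U V : {vspace vT} => (U <= V)%VS).
Proof. by move=> U V UV; apply: subv_anti. Qed.

HB.instance Definition _ :=
  Order.Le_isPOrder.Build vspace_display {vspace vT}
    (@subvv F vT) subv_antisym (@subv_trans F vT).

End VspaceOrder.

Definition hamming_weight (F : nzRingType) (n : nat) (v : 'rV[F]_n) : nat :=
  #|[set j | v 0 j != 0]|.

Section Dowling.
Context {F : finFieldType} {n : nat}.

Definition low_weight_basis (d : nat) (U : {vspace 'rV[F]_n}) : bool :=
  [exists X : (\dim U).-tuple 'rV[F]_n,
     basis_of U X && all (fun v => hamming_weight v <= d)%N X].

Definition in_dowling (d : nat) (U : {vspace 'rV[F]_n}) : bool :=
  (U == 0%VS) || low_weight_basis d U.

End Dowling.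

Record dowling (F : finFieldType) (n d : nat) := Dowling {
  dowling_space :> {vspace 'rV[F]_n};
  _ : in_dowling d dowling_space
}.

Section DowlingPoset.
Variables (F : finFieldType) (n d : nat).

HB.instance Definition _ := [isSub for @dowling_space F n d].
HB.instance Definition _ := [Finite of dowling F n d by <:].
HB.instance Definition _ :=
  [SubChoice_isSubPOrder of dowling F n d by <: with vspace_display].

Lemma in_dowling0 : in_dowling d (0%VS : {vspace 'rV[F]_n}).
Proof. by rewrite /in_dowling eqxx. Qed.

Definition dowling0 : dowling F n d := Dowling in_dowling0.

Lemma dowling_leE (U V : dowling F n d) :
  (U <= V)%O = (dowling_space U <= dowling_space V)%VS.
Proof. by []. Qed.

Definition dowling_whitney (i : nat) : int :=
  \sum_(U : dowling F n d | \dim U == i) mobius dowling0 U.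

End DowlingPoset.

Definition prime_powers : set nat :=
  [set q | exists p k : nat, [/\ prime p, (0 < k)%N & q = (p ^ k)%N]]%classic.

(* The field with [q] elements, well defined up to isomorphism;
   a dummy value if [q] is not a prime power. *)
Definition GF (q : nat) : finFieldType :=
  if pselect (exists F : finFieldType, #|F| = q) is left h
  then projT1 (cid h) else 'F_2.

Lemma card_GF q : prime_powers q -> #|GF q| = q.
Proof.
case=> p [k [pp k0 ->]]; rewrite /GF; case: pselect => [h|[]].
  exact: projT2 (cid h).
by case: (pPrimePowerField pp k0) => F _ cF; exists F.
Qed.

Definition whitney (q n d i : nat) : int := dowling_whitney (GF q) n d i.

(* Main.v *)
Require Import Defs.
From mathcomp Require Import all_boot all_order all_algebra all_field.
From mathcomp Require Import zify ring lra.

(**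
  The lattice has the zero space below its lines and the lines below its
  planes, so a plane [U] has Moebius value [a - 1], where [a] is the number of
  its low-weight lines.  A plane is spanned by [a * (a - 1) * (q - 1) ^ 2]
  ordered pairs of low-weight vectors, hence giving every independent pair of
  low-weight vectors the weight [1 / b], with [b = a * (q - 1)] the number of
  low-weight vectors in its span, yields [(q - 1)] times the second Whitney
  number ([whitney2_sum]).

  Low weight means having at least two zeros.  Sort the pairs [(x, y)]
  by their zero sets [(P, Q)].  A pair with three zeros in one vector loses a
  power of [q] in the count, and a pair with [P = Q] spans a plane with [q + 1]
  low-weight lines, so its weight is too small: both kinds contribute
  [O(q ^ (2 n - 6))].  The other types consist of [(q - 1) ^ (2 n - 4)] pairs
  with [#|P| = #|Q| = 2], and for all but a fraction [O(1 / q)] of them the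
  columns of the matrix with rows [x] and [y] are as independent as the zeros
  allow.  Then the span has two low-weight lines if [P] and [Q] are disjoint
  ([card_low_coefs_disjoint]) and [n - 1] of them if [P] and [Q] share one
  point ([card_low_coefs_meet]).  Counting types gives

    C(n, 2) * (C(n - 2, 2) / 2 + 2 (n - 2) / (n - 1))
      = n (n - 1) (n - 2) (n - 3) / 8 + n (n - 2),

  which is [whitney2_lead] ([type_weight_sum]).  The outcome is the
  explicit estimate [whitney2_estimate], uniform in the field for fixed [n].
  The asymptotic equivalence and the order of growth both follow since
  [whitney2_lead] is positive.
*)

Import Order.TTheory GRing.Theory Num.Theory.
Local Open Scope ring_scope.

(** * The second Whitney number as a sum over pairs of low-weight vectors *)

Section RankTwo.
Context {F : finFieldType} {n : nat} (d : nat).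
Implicit Types (u v w : 'rV[F]_n) (U W : {vspace 'rV[F]_n}).

Definition low_vectors U : {set 'rV[F]_n} :=
  [set v in U | (v != 0) && (hamming_weight v <= d)%N].

Lemma hamming_weightZ (c : F) v :
  c != 0 -> hamming_weight (c *: v) = hamming_weight v.
Proof. by move=> c0; apply: eq_card => j; rewrite !inE mxE mulf_eq0 (negPf c0). Qed.

Lemma in_dowling_span (X : seq 'rV[F]_n) :
  free X -> all (fun v => hamming_weight v <= d)%N X -> in_dowling d <<X>>%VS.
Proof.
move=> fX lX; apply/orP; right; apply/existsP.
have sX : size X == \dim <<X>>%VS by rewrite eq_sym; exact: fX.
by exists (Tuple sX); rewrite /= lX andbT basisEfree fX subvv /= (eqP sX).
Qed.

Lemma in_dowling_line v :
  v != 0 -> (hamming_weight v <= d)%N -> in_dowling d <[v]>%VS.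
Proof.
move=> v0 lv; rewrite -span_seq1; apply: in_dowling_span; first by rewrite seq1_free.
by rewrite /= lv.
Qed.

Lemma dowling_low_vector (U : dowling F n d) :
  dowling_space U != 0%VS -> exists v, v \in low_vectors U.
Proof.
case: U => U /= /orP[/eqP->|]; first by rewrite eqxx.
move=> /existsP[X /andP[bX lX]] U0.
have : (0 < size X)%N by rewrite size_tuple lt0n dimv_eq0.
case: X bX lX => -[|v X] sX //= bX /andP[lv _] _; exists v.
rewrite inE lv andbT (basis_mem bX) ?mem_head//=.
by have := basis_free bX; rewrite free_cons; apply: contraTneq => ->; rewrite mem0v.
Qed.

Lemma card_low_line w : w != 0 -> (hamming_weight w <= d)%N ->
  #|low_vectors <[w]>%VS| = #|F|.-1.
Proof.
move=> w0 lw.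
have -> : low_vectors <[w]>%VS = [set v | v \in <[w]>%VS] :\ 0.
  apply/setP => v; rewrite !inE; apply/and3P/andP => [[-> ->]//|[v0 vw]].
  split=> //; case/vlineP: vw v0 => c ->.
  by rewrite scaler_eq0 negb_or => /andP[c0 _]; rewrite hamming_weightZ.
have := cardsD1 0 [set v | v \in <[w]>%VS].
rewrite inE mem0v add1n cardsE card_vspace dim_vline w0 expn1 => ->.
by [].
Qed.

Definition dowling_lines U : {set dowling F n d} :=
  [set z : dowling F n d | (\dim z == 1) && (dowling_space z <= U)%VS].

Lemma vline_dim1 v W : \dim W = 1%N -> v != 0 -> v \in W -> <[v]>%VS = W.
Proof.
move=> dW v0 vW; apply/eqP; rewrite eqEdim dim_vline v0 dW andbT.
by rewrite -memvE.
Qed.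

(** Every nonzero low-weight vector spans a line of the lattice, and by
    [card_low_line] each such line is hit [#|F|.-1] times. *)
Lemma card_dowling_lines U :
  (#|dowling_lines U| * #|F|.-1)%N = #|low_vectors U|.
Proof.
pose line_of v : dowling F n d := insubd (dowling0 F n d) <[v]>%VS.
have line_ofE v : v \in low_vectors U -> dowling_space (line_of v) = <[v]>%VS.
  by rewrite inE => /and3P[_ v0 lv]; rewrite [LHS]insubdK //; apply: in_dowling_line.
rewrite -sum1_card -[RHS]sum1_card.
rewrite [RHS](partition_big line_of [in dowling_lines U]) /=; last first.
  move=> v vU; rewrite inE line_ofE // dim_vline -memvE.
  by move: vU; rewrite inE => /and3P[-> -> _].
rewrite big_distrl /=; apply: eq_bigr => z; rewrite inE => /andP[/eqP dz zU].
rewrite mul1n.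
have [w] : exists v, v \in low_vectors z.
  by apply: dowling_low_vector; rewrite -dimv_eq0 dz.
rewrite inE => /and3P[wz w0 lw].
rewrite -(card_low_line w w0 lw) (vline_dim1 _ _ dz w0 wz) -sum1_card.
apply: eq_bigl => v; apply/idP/andP => [vz|[vU /eqP <-]].
  move: (vz); rewrite inE => /and3P[vz' v0 lv].
  have vU : v \in low_vectors U by rewrite inE v0 lv andbT (subvP zU).
  by split=> //; apply/eqP/val_inj => /=; rewrite line_ofE //; apply: vline_dim1.
by move: (vU); rewrite !inE line_ofE // memv_line => /and3P[_ -> ->].
Qed.

Lemma dowling0_le (z : dowling F n d) : (dowling0 F n d <= z)%O.
Proof. by rewrite dowling_leE sub0v. Qed.

Lemma mobius_dowling00 : mobius (dowling0 F n d) (dowling0 F n d) = 1.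
Proof.
rewrite mobiusE eqxx big1 ?subr0// => z /andP[z0 /(le_lt_trans z0)].
by rewrite ltxx.
Qed.

Lemma dowling_dim0 (z : dowling F n d) : (\dim z == 0) = (z == dowling0 F n d).
Proof. by rewrite dimv_eq0 -(inj_eq val_inj). Qed.

Lemma dowling_lt_dim (z U : dowling F n d) : (z < U)%O -> (\dim z < \dim U)%N.
Proof.
rewrite lt_neqAle dowling_leE => /andP[zU leU]; rewrite ltn_neqAle dimvS // andbT.
by apply: contraNneq zU => e; apply/eqP/val_inj/eqP; rewrite /= eqEdim leU e /=.
Qed.

Lemma mobius_dowling_line (z : dowling F n d) :
  \dim z = 1%N -> mobius (dowling0 F n d) z = -1.
Proof.
move=> dz; have z0 : z != dowling0 F n d by rewrite -dowling_dim0 dz.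
rewrite mobiusE eq_sym (negPf z0) sub0r (big_pred1 (dowling0 F n d)) ?mobius_dowling00//.
move=> t /=; rewrite dowling0_le /= -dowling_dim0; apply/idP/idP.
  by move/dowling_lt_dim; rewrite dz ltnS leqn0.
by rewrite dowling_dim0 => /eqP ->; rewrite lt_neqAle eq_sym z0 dowling0_le.
Qed.

(** Strictly below a plane lie only the zero space, with Moebius value 1, and
    the lines, with value -1. *)
Lemma mobius_dowling_plane (U : dowling F n d) : \dim U = 2%N ->
  mobius (dowling0 F n d) U = #|dowling_lines U|%:R - 1.
Proof.
move=> dU; have U0 : U != dowling0 F n d by rewrite -dowling_dim0 dU.
rewrite mobiusE eq_sym (negPf U0) sub0r (bigD1 (dowling0 F n d)) /=; last first.
  by rewrite lexx lt_neqAle eq_sym U0 dowling0_le.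
rewrite mobius_dowling00 opprD addrC; congr (_ - _).
rewrite -sumrN -sumr_const.
rewrite [RHS](eq_bigr (fun z => - mobius (dowling0 F n d) z)); last first.
  by move=> z; rewrite inE => /andP[/eqP dz _]; rewrite mobius_dowling_line ?opprK.
apply: eq_bigl => z; rewrite inE dowling0_le /= -dowling_dim0.
apply/andP/andP => [[zU z0]|[/eqP dz zU]].
  split; last by move/ltW: zU.
  by move/dowling_lt_dim: zU; rewrite dU; case: (\dim z) z0 => [|[]].
split; last by rewrite dz.
rewrite lt_neqAle dowling_leE zU andbT.
by apply/eqP => e; move: dU; rewrite -e dz.
Qed.

Lemma free2P (x y : 'rV[F]_n) :
  reflect (forall s t, s *: x + t *: y = 0 -> (s == 0) && (t == 0)) (free [:: x; y]).
Proof.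
rewrite free_cons span_seq1 seq1_free; apply: (iffP andP) => [[xy y0] s t e|h].
  have [s0|s0] := eqVneq s 0.
    move/eqP: e; rewrite s0 scale0r add0r scaler_eq0 (negPf y0) orbF.
    by move=> ->; rewrite ?eqxx.
  case/negP: xy; apply/vlineP; exists (- (s^-1 * t)).
  apply: (scalerI s0); rewrite scalerA mulrN mulrA mulfV // mul1r scaleNr.
  by apply/eqP; rewrite -addr_eq0 e.
split; last first.
  apply/eqP => y0; have := h 0 1; rewrite y0 scale0r scaler0 addr0 eqxx oner_eq0.
  by move/(_ erefl).
apply/vlineP => -[c e]; have := h 1 (- c).
by rewrite e scale1r scaleNr subrr oner_eq0 => /(_ erefl).
Qed.

Definition low_coefs (x y : 'rV[F]_n) : {set F * F} :=
  [set c | ((c.1 != 0) || (c.2 != 0)) &&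
           (hamming_weight (c.1 *: x + c.2 *: y) <= d)%N].

(** Coordinates in the basis [x], [y] make the number of low-weight vectors of
    a plane computable from any pair that spans it. *)
Lemma card_low_coefs (x y : 'rV[F]_n) :
  free [:: x; y] -> #|low_coefs x y| = #|low_vectors <<[:: x; y]>>%VS|.
Proof.
move=> /free2P fxy; pose f (c : F * F) := c.1 *: x + c.2 *: y.
have f_inj : injective f.
  move=> [a b] [a' b'] /eqP; rewrite -subr_eq0 opprD addrACA -!scalerBl /=.
  by move=> /eqP/fxy; rewrite !subr_eq0 => /andP[/eqP-> /eqP->].
rewrite -(card_imset _ f_inj); congr (#| pred_of_set _ |); apply/setP => v.
have spanE w : w \in <<[:: x; y]>>%VS = (w \in f @: setT).
  rewrite span_cons span_seq1; apply/memv_addP/imsetP.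
    by move=> [_ /vlineP[a ->] [_ /vlineP[b ->] ->]]; exists (a, b).
  move=> [[a b] _ ->]; exists (a *: x); rewrite ?memvZ ?memv_line//.
  by exists (b *: y); rewrite ?memvZ ?memv_line.
have fN0 c : (f c != 0) = ((c.1 != 0) || (c.2 != 0)).
  rewrite -negb_and; congr negb; apply/eqP/idP; first exact: fxy.
  by move=> /andP[/eqP c1 /eqP c2]; rewrite /f c1 c2 !scale0r addr0.
rewrite inE spanE; apply/imsetP/andP => [[c]|[/imsetP[c _ ->]]].
  by rewrite inE -fN0 => /andP[f0 lf] ->; rewrite f0 lf imset_f.
by rewrite fN0 => lf; exists c; rewrite // inE.
Qed.

Lemma span_plane (x y : 'rV[F]_n) W : \dim W = 2%N -> free [:: x; y] ->
  x \in W -> y \in W -> <<[:: x; y]>>%VS = W.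
Proof.
move=> dW fxy xW yW; apply/eqP; rewrite eqEdim.
have -> : \dim <<[:: x; y]>>%VS = 2%N by apply/eqP; exact: fxy.
rewrite dW leqnn andbT; apply/span_subvP => z.
by rewrite !inE => /orP[] /eqP->.
Qed.

Definition low_pairs : {set 'rV[F]_n * 'rV[F]_n} :=
  [set p : 'rV[F]_n * 'rV[F]_n | [&& free [:: p.1; p.2], (hamming_weight p.1 <= d)%N
             & (hamming_weight p.2 <= d)%N]].

(** Once [x] is chosen, [y] may be any low-weight vector of [U] off the line
    of [x]; all nonzero vectors of that line have low weight. *)
Lemma card_low_pairs U :
  (#|[set p in low_pairs | (p.1 \in U) && (p.2 \in U)]|
     = #|low_vectors U| * (#|low_vectors U| - #|F|.-1))%N.
Proof.
rewrite -sum1_card.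
transitivity (\sum_(x in low_vectors U) \sum_(y in low_vectors U :\: low_vectors <[x]>%VS) 1)%N.
  rewrite pair_big_dep; apply: eq_bigl => -[x y] /=.
  rewrite !inE /= free_cons span_seq1 seq1_free.
  have [xy|xy] := boolP (x \in <[y]>%VS).
    rewrite /=; symmetry; apply/negP => /andP[/and3P[xU x0 lx] /andP[yx /and3P[yU y0 ly]]].
    case/negP: yx; rewrite y0 ly !andbT; case/vlineP: xy x0 => c ->.
    rewrite scaler_eq0 negb_or => /andP[c0 _]; apply/vlineP; exists c^-1.
    by rewrite scalerA mulVf ?scale1r.
  have [-> | y0] := eqVneq y 0; first by rewrite /= !andbF.
  have [x0 | x0] := eqVneq x 0; first by rewrite x0 mem0v in xy.
  have yx : y \notin <[x]>%VS.
    apply: contra xy => /vlineP[c e]; move: y0; rewrite e scaler_eq0 negb_or => /andP[c0 _].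
    by apply/vlineP; exists c^-1; rewrite scalerA mulVf ?scale1r.
  rewrite (negPf yx) /=.
  by case: (x \in U); case: (y \in U); rewrite /= ?andbF ?andbT.
rewrite -sum_nat_const; apply: eq_bigr => x; rewrite inE => /and3P[xU x0 lx].
rewrite sum1_card cardsD -(card_low_line x x0 lx); congr (_ - _)%N.
apply: eq_card => y; rewrite !inE; case: (boolP (y \in <[x]>%VS)) => [yx|]; last by rewrite andbF.
have -> : y \in U by case/vlineP: yx => c ->; rewrite memvZ.
by rewrite /= andbb.
Qed.

(** A plane [U] of the lattice with [b] low-weight vectors is spanned by
    [b * (b - (#|F| - 1))] pairs.  Giving each pair the weight [1 / b] leaves
    [b - (#|F| - 1)], which is [#|F| - 1] times the Moebius value of [U].
    This replaces a sum over subspaces by one over vectors. *)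
Lemma whitney2_sum (R : realFieldType) :
  (#|F|.-1)%:R * (dowling_whitney F n d 2)%:~R =
  \sum_(p in low_pairs) (#|low_coefs p.1 p.2|%:R)^-1 :> R.
Proof.
pose plane_of (p : 'rV[F]_n * 'rV[F]_n) : dowling F n d :=
  insubd (dowling0 F n d) <<[:: p.1; p.2]>>%VS.
have plane_ofE p : p \in low_pairs -> dowling_space (plane_of p) = <<[:: p.1; p.2]>>%VS.
  rewrite inE => /and3P[fp l1 l2]; rewrite [LHS]insubdK //.
  by apply: in_dowling_span; rewrite //= l1 l2.
rewrite [RHS](partition_big plane_of (fun U : dowling F n d => \dim U == 2)) /=; last first.
  by move=> p pl; rewrite plane_ofE //; move: pl; rewrite inE => /and3P[fp _ _]; exact: fp.
rewrite /dowling_whitney raddf_sum big_distrr /=; apply: eq_bigr => U /eqP dU.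
have [w wU] : exists v, v \in low_vectors U.
  by apply: dowling_low_vector; rewrite -dimv_eq0 dU.
set b := #|low_vectors U|.
have b0 : (0 < b)%N by rewrite /b (cardD1 w) wU.
rewrite (eq_bigr (fun=> (b%:R)^-1 : R)); last first.
  move=> p /andP[pl /eqP e]; rewrite card_low_coefs -?plane_ofE ?e //.
  by move: pl; rewrite inE => /and3P[].
rewrite (eq_bigl [in [set p in low_pairs | (p.1 \in U) && (p.2 \in U)]]); last first.
  move=> p; rewrite [RHS]inE; apply: andb_id2l => pl.
  rewrite -(inj_eq val_inj) /= plane_ofE //; apply/eqP/andP => [<-|[p1 p2]].
    by rewrite !memv_span ?inE ?eqxx ?orbT.
  by apply: span_plane => //; move: pl; rewrite inE => /and3P[].
rewrite sumr_const card_low_pairs -/b -[RHS]mulr_natr natrM mulrA mulVf ?pnatr_eq0 ?gtn_eqF // mul1r.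
have le_b : (#|F|.-1 <= b)%N.
  move: wU; rewrite inE => /and3P[wU w0 lw].
  rewrite -(card_low_line w w0 lw); apply: subset_leq_card; apply/subsetP => v.
  rewrite !inE => /and3P[/vlineP[c ->] -> ->]; by rewrite memvZ.
rewrite natrB // /b -card_dowling_lines mobius_dowling_plane //.
by rewrite rmorphB /= rmorph1 mulrBr mulr1 natrM mulrC; congr (_ * _ - _); rewrite rmorph_nat.
Qed.

End RankTwo.

(** * Counting the low-weight combinations of two vectors by their zeros *)

Lemma cards2_inj (T : finType) (P : {set T}) (i l m : T) :
  #|P| = 2%N -> i \in P -> l \in P -> m \in P -> l != i -> m != i -> l = m.
Proof.
move=> cP iP lP mP li mi; apply/eqP; apply: contraT => lm.
have : [set i; l; m] \subset P.
  by apply/subsetP => j; rewrite !inE -orbA => /or3P[] /eqP->.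
move/subset_leq_card; rewrite cP -setUA cardsU1 cards2 lm !inE.
by rewrite eq_sym (negPf li) eq_sym (negPf mi).
Qed.

Section ZeroSets.
Context {F : finFieldType} {n : nat}.
Implicit Types (u v w x y : 'rV[F]_n) (P Q D J : {set 'I_n}).

Definition zeros v : {set 'I_n} := [set j | v 0 j == 0].

Lemma cardsC_ord P : #|~: P| = (n - #|P|)%N.
Proof. by have := cardsC P; rewrite card_ord; lia. Qed.

Lemma low_weight_zeros v : (2 <= n)%N ->
  (hamming_weight v <= n - 2)%N = (2 <= #|zeros v|)%N.
Proof.
move=> n2; have -> : hamming_weight v = (n - #|zeros v|)%N.
  by rewrite -cardsC_ord; apply: eq_card => j; rewrite !inE.
have : (#|zeros v| <= n)%N by rewrite -[leqRHS](card_ord n) max_card.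
lia.
Qed.

Lemma card_vectors_on D (K : {pred F}) :
  #|[set v : 'rV[F]_n | [forall j, if j \in D then v 0 j \in K else v 0 j == 0]]|
    = (#|K| ^ #|D|)%N.
Proof.
rewrite -(card_pffun_on 0 D K).
pose g (f : {ffun 'I_n -> F}) : 'rV[F]_n := \row_j f j.
have g_inj : injective g.
  by move=> f f' /rowP e; apply/ffunP => j; have := e j; rewrite !mxE.
rewrite -(card_imset _ g_inj); apply: eq_card => v.
rewrite inE; apply/forallP/imsetP => [h|[f /pfamilyP[sf fK] ->] j].
  exists [ffun j => v 0 j]; last by apply/rowP => j; rewrite mxE ffunE.
  apply/pfamilyP; split=> [|j jD].
    by apply/supportP => j jD; have := h j; rewrite (negPf jD) ffunE => /eqP.
  by have := h j; rewrite jD ffunE.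
rewrite mxE; case: ifP => [/fK//|/negbT jD].
by apply: contraNT jD => fj; apply: (subsetP sf); rewrite inE.
Qed.

Lemma card_vanishing P :
  #|[set v : 'rV[F]_n | P \subset zeros v]| = (#|F| ^ (n - #|P|))%N.
Proof.
rewrite -cardsC_ord -(card_vectors_on (~: P) predT).
apply: eq_card => v; rewrite !inE; apply/subsetP/forallP => h j.
  by rewrite inE; case: ifP => // /negbFE /h; rewrite inE.
by move=> jP; have := h j; rewrite !inE jP.
Qed.

Lemma card_zeros P :
  #|[set v : 'rV[F]_n | zeros v == P]| = (#|F|.-1 ^ (n - #|P|))%N.
Proof.
rewrite -cardsC_ord -(cardsC1 (0 : F)) -(card_vectors_on (~: P) [in [set~ 0]]).
apply: eq_card => v; rewrite !inE; apply/eqP/forallP => [<-|h].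
  by move=> j; rewrite !inE; case: ifP => // /negbFE.
by apply/setP => j; have := h j; rewrite !inE; case: (j \in P) => //= /negPf.
Qed.

(** The nonzero coefficient pairs of combinations that vanish at a coordinate
    where the two vectors take the values [a] and [b]. *)
Definition ortho (a b : F) : {set F * F} :=
  [set c | ((c.1 != 0) || (c.2 != 0)) && (c.1 * a + c.2 * b == 0)].

Lemma card_ortho (a b : F) : (a != 0) || (b != 0) -> #|ortho a b| = #|F|.-1.
Proof.
move=> ab; pose f (t : F) := (t * b, - (t * a)).
have f_inj : injective f.
  move=> s t [eb /oppr_inj ea].
  case/orP: ab => [a0|b0]; [exact: (mulIf a0) | exact: (mulIf b0)].
rewrite -(cardsC1 (0 : F)) -(card_imset _ f_inj); apply: eq_card => -[s t].
rewrite inE /=; apply/andP/imsetP => [[st /eqP e]|[r r0 [-> ->]]].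
  have [a0|a0] := eqVneq a 0.
    have b0 : b != 0 by move: ab; rewrite a0 eqxx.
    have t0 : t = 0 by apply: (mulIf b0); rewrite mul0r -e a0 mulr0 add0r.
    exists (s / b); last by rewrite /f a0 mulr0 oppr0 divfK // t0.
    by move: st; rewrite !inE t0 eqxx orbF => s0; rewrite mulf_neq0 ?invr_eq0.
  have es : s = - (t * b) / a.
    by apply: (mulIf a0); rewrite divfK //; apply/eqP; rewrite -addr_eq0 e.
  exists (- t / a); last by rewrite /f divfK // opprK es; congr (_, _); ring.
  rewrite !inE mulf_neq0 ?invr_eq0 // oppr_eq0.
  by apply: contraTneq st => t0; rewrite es t0 mul0r oppr0 mul0r eqxx.
move: r0; rewrite !inE => r0; rewrite oppr_eq0 !mulf_eq0 (negPf r0) /= orbC ab; split=> //.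
by apply/eqP; ring.
Qed.

Lemma low_coefs_zeros x y (c : F * F) : (2 <= n)%N ->
  (c \in low_coefs (n - 2) x y) =
  ((c.1 != 0) || (c.2 != 0)) && (2 <= #|zeros (c.1 *: x + c.2 *: y)|)%N.
Proof. by move=> n2; rewrite inE low_weight_zeros. Qed.

Lemma in_zeros_comb x y (c : F * F) j :
  (j \in zeros (c.1 *: x + c.2 *: y)) = (c.1 * x 0 j + c.2 * y 0 j == 0).
Proof. by rewrite inE !mxE. Qed.

(** Two nonproportional columns impose independent conditions, so only the
    zero pair is orthogonal to both. *)
Lemma ortho_eq0 (a b a' b' : F) (c : F * F) :
  c \in ortho a b -> c \in ortho a' b' -> a * b' = a' * b.
Proof.
rewrite !inE => /andP[c0 /eqP e] /andP[_ /eqP e'].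
have h1 : c.1 * (a * b' - a' * b) = 0.
  by transitivity (b' * (c.1 * a + c.2 * b) - b * (c.1 * a' + c.2 * b')); [ring|rewrite e e'; ring].
have h2 : c.2 * (a * b' - a' * b) = 0.
  by transitivity (a * (c.1 * a' + c.2 * b') - a' * (c.1 * a + c.2 * b)); [ring|rewrite e e'; ring].
apply/eqP; rewrite -subr_eq0; case/orP: c0 => c0; apply/eqP.
  by apply: (mulfI c0); rewrite mulr0.
by apply: (mulfI c0); rewrite mulr0.
Qed.

(** The sets of coefficients attached to pairwise nonproportional columns are
    disjoint and have [#|F| - 1] elements each. *)
Lemma card_low_coefs_cover x y J :
  low_coefs (n - 2) x y = \bigcup_(j in J) ortho (x 0 j) (y 0 j) ->
  {in J, forall j, (x 0 j != 0) || (y 0 j != 0)} ->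
  {in J &, forall l m, l != m -> x 0 l * y 0 m != x 0 m * y 0 l} ->
  #|low_coefs (n - 2) x y| = (#|J| * #|F|.-1)%N.
Proof.
move=> -> nz np; rewrite big_mkcond -sum1_card partition_disjoint_bigcup; last first.
  move=> l m lm; rewrite -setI_eq0; apply/eqP/setP => c; rewrite in_set0.
  have [lJ|_] := ifP; last by rewrite set0I inE.
  have [mJ|_] := ifP; last by rewrite setI0 inE.
  apply/negP => /setIP[cl cm]; move/negP: (np _ _ lJ mJ lm); apply.
  by apply/eqP; exact: ortho_eq0 cl cm.
rewrite -sum_nat_const [RHS]big_mkcond; apply: eq_bigr => j _.
case: ifP => jJ; last by rewrite big_set0.
by rewrite sum1_card card_ortho // nz.
Qed.

(** Meant for [P] and [Q] the zero sets of [x] and [y]: whether two columns of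
    the matrix with rows [x] and [y] are proportional is then decided by the
    zeros alone as soon as one of the columns lies in [P :|: Q], and only the
    other columns are constrained here. *)
Definition generic P Q x y :=
  [forall l, forall m, [&& l \notin P :|: Q, m \notin P :|: Q & l != m] ==>
     (x 0 l * y 0 m != x 0 m * y 0 l)].

Lemma genericP P Q x y : reflect
  (forall l m, l \notin P :|: Q -> m \notin P :|: Q -> l != m ->
     x 0 l * y 0 m != x 0 m * y 0 l)
  (generic P Q x y).
Proof.
apply: (iffP forallP) => h l => [m lPQ mPQ lm|].
  by have /forallP/(_ m)/implyP := h l; apply; rewrite lPQ mPQ.
by apply/forallP => m; apply/implyP => /and3P[lPQ mPQ lm]; apply: h.
Qed.

(** When the two zero sets share one coordinate [i], every combination vanishes
    at [i], so it has low weight as soon as it vanishes at one of the [n - 1]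
    other coordinates.  Their columns are pairwise nonproportional. *)
Lemma card_low_coefs_meet x y : (2 <= n)%N ->
  #|zeros x| = 2%N -> #|zeros y| = 2%N -> #|zeros x :&: zeros y| = 1%N ->
  generic (zeros x) (zeros y) x y ->
  #|low_coefs (n - 2) x y| = (n.-1 * #|F|.-1)%N.
Proof.
move=> n2 cx cy cI /genericP gen.
have [i defI] : exists i, zeros x :&: zeros y = [set i] by apply/cards1P; rewrite cI.
have /setIP[ix iy] : i \in zeros x :&: zeros y by rewrite defI set11.
have notboth l : l != i -> ~~ ((l \in zeros x) && (l \in zeros y)).
  by move=> li; rewrite -in_setI defI inE.
have -> : n.-1 = #|[set~ i]| by rewrite cardsC1 card_ord.
apply: card_low_coefs_cover.
- apply/setP => c; rewrite low_coefs_zeros //; apply/andP/bigcupP => [[c0 z2]|[j ji]].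
    have : (0 < #|zeros (c.1 *: x + c.2 *: y) :\ i|)%N.
      rewrite -ltnS; apply: leq_trans z2 _.
      by rewrite (cardsD1 i) -[leqRHS]add1n leq_add2r leq_b1.
    case/card_gt0P => j; rewrite inE in_zeros_comb inE => /andP[ji e].
    by exists j; rewrite ?inE // c0 e.
  move: ji; rewrite !inE => ji /andP[c0 e]; split=> //.
  apply: (@leq_trans #|[set i; j]|); first by rewrite cards2 eq_sym ji.
  apply: subset_leq_card; apply/subsetP => k; rewrite !inE => /orP[] /eqP ->; rewrite !mxE //.
  by move: ix iy; rewrite !inE => /eqP-> /eqP->; rewrite !mulr0 addr0.
- by move=> j; rewrite !inE => /notboth; rewrite !inE negb_and.
move=> l m; rewrite !inE => li mi lm.
have [lx|lx] := boolP (l \in zeros x).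
  have mx : m \notin zeros x by apply: contraNN lm => mx; apply/eqP; exact: cards2_inj cx ix lx mx li mi.
  have := notboth _ li; rewrite lx /= => ly.
  move: lx mx ly; rewrite !inE => /eqP-> mx ly.
  by rewrite mul0r eq_sym mulf_neq0 // eq_sym.
have [ly|ly] := boolP (l \in zeros y).
  have my : m \notin zeros y by apply: contraNN lm => my; apply/eqP; exact: cards2_inj cy iy ly my li mi.
  move: lx my ly; rewrite !inE => lx my /eqP->.
  by rewrite mulr0 mulf_neq0.
have [mx|mx] := boolP (m \in zeros x).
  have := notboth _ mi; rewrite mx /= => my.
  move: lx mx my; rewrite !inE => lx /eqP-> my.
  by rewrite mul0r mulf_neq0.
have [my|my] := boolP (m \in zeros y).
  move: mx my ly; rewrite !inE => mx /eqP-> ly.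
  by rewrite mulr0 eq_sym mulf_neq0.
by apply: gen => //; rewrite inE negb_or ?lx ?ly ?mx ?my.
Qed.

(** When the zero sets are disjoint, a combination with both coefficients
    nonzero vanishes at most once, by genericity: the only low-weight vectors
    are the multiples of [x] and of [y].  A coordinate [i] where [x] vanishes
    detects the former, and a coordinate [k] where [y] vanishes the latter. *)
Lemma card_low_coefs_disjoint x y : (2 <= n)%N ->
  #|zeros x| = 2%N -> #|zeros y| = 2%N -> zeros x :&: zeros y = set0 ->
  generic (zeros x) (zeros y) x y ->
  #|low_coefs (n - 2) x y| = (2 * #|F|.-1)%N.
Proof.
move=> n2 cx cy dxy /genericP gen.
have notboth l : ~~ ((l \in zeros x) && (l \in zeros y)) by rewrite -in_setI dxy inE.
have [i ix] : exists i, i \in zeros x by apply/card_gt0P; rewrite cx.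
have [k ky] : exists k, k \in zeros y by apply/card_gt0P; rewrite cy.
have iy : i \notin zeros y by have := notboth i; rewrite ix.
have kx : k \notin zeros x by have := notboth k; rewrite ky andbT.
have ik : i != k by apply: contraNneq iy => ->.
have -> : (2 * #|F|.-1 = #|[set i; k]| * #|F|.-1)%N by rewrite cards2 ik.
move: (ix) (iy) (kx) (ky); rewrite !inE => /eqP xi yi xk /eqP yk.
apply: card_low_coefs_cover.
- apply/setP => c; rewrite low_coefs_zeros //; apply/andP/bigcupP => [[c0 z2]|[j ji]].
    have [c1|c1] := eqVneq c.1 0.
      exists k; first by rewrite !inE eqxx orbT.
      by rewrite inE c0 c1 yk mul0r mulr0 addr0 eqxx.
    have [c2|c2] := eqVneq c.2 0.
      exists i; first by rewrite !inE eqxx.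
      by rewrite inE c0 c2 xi mul0r mulr0 addr0 eqxx.
    exfalso; case/card_gt1P: z2 => a [b [za zb ab]].
    have zN j : j \in zeros (c.1 *: x + c.2 *: y) -> j \notin zeros x :|: zeros y.
      rewrite in_zeros_comb => e; apply/negP => /setUP[] jz; have := notboth j.
        rewrite jz /=; move: jz e; rewrite !inE => /eqP->.
        by rewrite mulr0 add0r mulf_eq0 (negPf c2) /= => ->.
      rewrite jz andbT; move: jz e; rewrite !inE => /eqP->.
      by rewrite mulr0 addr0 mulf_eq0 (negPf c1) /= => ->.
    have oz j : j \in zeros (c.1 *: x + c.2 *: y) -> c \in ortho (x 0 j) (y 0 j).
      by rewrite in_zeros_comb inE c0.
    by have /eqP[] := gen a b (zN _ za) (zN _ zb) ab; apply: (@ortho_eq0 _ _ _ _ c); apply: oz.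
  move: ji; rewrite !inE => /orP[]/eqP-> /andP[c0]; rewrite c0.
    rewrite xi mulr0 add0r mulf_eq0 (negPf yi) orbF => /eqP c2; split=> //.
    rewrite -cx; apply: subset_leq_card; apply/subsetP => a.
    by rewrite !inE !mxE c2 mul0r addr0 => /eqP->; rewrite mulr0.
  rewrite yk mulr0 addr0 mulf_eq0 (negPf xk) orbF => /eqP c1; split=> //.
  rewrite -cy; apply: subset_leq_card; apply/subsetP => a.
  by rewrite !inE !mxE c1 mul0r add0r => /eqP->; rewrite mulr0.
- by move=> j; rewrite !inE => /orP[] /eqP->; rewrite ?xk ?yi ?orbT.
move=> l m; rewrite !inE => /orP[]/eqP-> /orP[]/eqP->; rewrite ?eqxx // xi yk.
  by move=> _; rewrite mul0r eq_sym mulf_neq0.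
by move=> _; rewrite mul0r mulf_neq0.
Qed.

Lemma card_low_coefs_same x y : (2 <= n)%N ->
  (2 <= #|zeros x|)%N -> zeros x = zeros y ->
  #|low_coefs (n - 2) x y| = (#|F| ^ 2 - 1)%N.
Proof.
move=> n2 cx exy.
have -> : low_coefs (n - 2) x y = [set~ (0, 0)].
  apply/setP => -[s t]; rewrite low_coefs_zeros // !inE xpair_eqE negb_and.
  case: (_ || _) => //=; apply: leq_trans cx _; apply: subset_leq_card.
  apply/subsetP => j jx; move: (jx); rewrite exy; move: jx; rewrite !inE !mxE.
  by move=> /eqP-> /eqP->; rewrite !mulr0 addr0.
by rewrite cardsC1 card_prod subn1.
Qed.

(** A proportionality between two columns [l] and [m] determines the entry of
    [x] at [l] from the other entries, which costs one power of [#|F|]. *)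
Lemma card_nongeneric P Q : #|P| = 2%N -> #|Q| = 2%N ->
  (#|[set p : 'rV[F]_n * 'rV[F]_n |
       [&& zeros p.1 == P, zeros p.2 == Q & ~~ generic P Q p.1 p.2]]|
   <= n ^ 2 * #|F| ^ (2 * n - 5))%N.
Proof.
move=> cP cQ.
pose bad (lm : 'I_n * 'I_n) := [set p : 'rV[F]_n * 'rV[F]_n |
  [&& zeros p.1 == P, zeros p.2 == Q,
   [&& lm.1 \notin P :|: Q, lm.2 \notin P :|: Q & lm.1 != lm.2]
   & p.1 0 lm.1 * p.2 0 lm.2 == p.1 0 lm.2 * p.2 0 lm.1]].
apply: (@leq_trans #|\bigcup_lm bad lm|).
  apply: subset_leq_card; apply/subsetP => p; rewrite inE => /and3P[p1 p2].
  rewrite negb_forall => /existsP[l]; rewrite negb_forall => /existsP[m].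
  rewrite negb_imply negbK => /andP[h e].
  by apply/bigcupP; exists (l, m); rewrite // inE p1 p2 h.
apply: (@leq_trans (\sum_lm #|bad lm|)%N).
  elim/big_ind2: _ => // [|A a B b lA lB]; first by rewrite cards0.
  apply: leq_trans (leq_add lA lB).
  by rewrite cardsU leq_subr.
have -> : (n ^ 2)%N = #|{: 'I_n * 'I_n}| by rewrite card_prod card_ord.
rewrite -sum_nat_const; apply: leq_sum => -[l m] _.
have [lP|lP] := boolP [&& l \notin P :|: Q, m \notin P :|: Q & l != m]; last first.
  rewrite (_ : bad _ = set0) ?cards0 //; apply/setP => p.
  by rewrite !inE /= in lP *; rewrite (negPf lP) !andbF.
case/and3P: lP => lPQ mPQ lm.
(* erases the entry that the proportionality determines *)
pose kill (p : 'rV[F]_n * 'rV[F]_n) : 'rV[F]_n * 'rV[F]_n :=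
  (\row_j (if j == l then 0 else p.1 0 j), p.2).
have kill_inj : {in bad (l, m) &, injective kill}.
  move=> [x y] [x' y']; rewrite !inE /=.
  move=> /and4P[_ /eqP zy _ /eqP e] /and4P[_ _ _ /eqP e'] [/rowP ex ey].
  congr (_, _) => //; apply/rowP => j; have := ex j; rewrite !mxE.
  case: eqP => [-> _|//].
  have ym : y 0 m != 0.
    by move: mPQ; rewrite inE negb_or -zy => /andP[_]; rewrite inE.
  apply: (mulIf ym); rewrite e [in RHS]ey e' -ey; congr (_ * _).
  by have := ex m; rewrite !mxE eq_sym (negPf lm).
rewrite -(card_in_imset kill_inj).
apply: (@leq_trans #|setX [set v : 'rV[F]_n | (l |: P) \subset zeros v]
                         [set v : 'rV[F]_n | Q \subset zeros v]|).
  apply: subset_leq_card; apply/subsetP => _ /imsetP[[x y] + ->].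
  rewrite !inE /= => /and3P[/eqP <- /eqP<- _]; rewrite subxx andbT.
  by apply/subsetP => j; rewrite !inE !mxE; case: eqP.
rewrite cardsX !card_vanishing cardsU1 cP cQ.
have -> : l \notin P by move: lPQ; rewrite inE negb_or => /andP[].
rewrite -expnD leq_exp2l ?finNzRing_gt1 //.
have : (#|l |: P| <= n)%N by rewrite -[leqRHS](card_ord n) max_card.
rewrite cardsU1 cP.
have -> : l \notin P by move: lPQ; rewrite inE negb_or => /andP[].
lia.
Qed.

End ZeroSets.

(** * Estimate over a fixed finite field *)

Definition whitney2_lead (R : realFieldType) (n : nat) : R :=
  1 / 8 * n%:R ^+ 4 - 3 / 4 * n%:R ^+ 3 + 19 / 8 * n%:R ^+ 2 - 11 / 4 * n%:R.

(** Passing from powers of [#|F| - 1] to powers of [#|F|] only costs a term of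
    lower order. *)
Lemma expr_pred_gap (R : realFieldType) (t : R) (k : nat) : 1 <= t ->
  0 <= t ^+ k.+1 - (t - 1) ^+ k.+1 <= k.+1%:R * t ^+ k.
Proof.
move=> t1; have t0 : 0 <= t by lra.
have tp : 0 <= t - 1 by lra.
elim: k => [|k /andP[IH1 IH2]]; first by rewrite !expr1 expr0; lra.
have e : t ^+ k.+2 - (t - 1) ^+ k.+2
    = t * (t ^+ k.+1 - (t - 1) ^+ k.+1) + (t - 1) ^+ k.+1.
  by rewrite !exprS; ring.
have tk : 0 <= (t - 1) ^+ k.+1 <= t ^+ k.+1.
  rewrite exprn_ge0 //=; apply: lerXn2r; rewrite ?nnegrE //; lra.
have /andP[tk0 tk1] := tk.
apply/andP; split; rewrite e; first by rewrite addr_ge0 // mulr_ge0.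
have -> : k.+2%:R * t ^+ k.+1 = t * (k.+1%:R * t ^+ k) + t ^+ k.+1.
  by rewrite -[k.+2%:R]natr1 mulrDl mul1r; congr (_ + _); rewrite mulrCA -exprS.
by rewrite lerD // ler_wpM2l.
Qed.

Section ZeroTypes.
Variables (R : realFieldType) (F : finFieldType) (n : nat).
Hypothesis n4 : (4 <= n)%N.
Implicit Types (x y : 'rV[F]_n) (P Q : {set 'I_n}).

Let q : R := #|F|%:R.

Let n2 : (2 <= n)%N. Proof. lia. Qed.

Let q_ge2 : 2 <= q. Proof. by rewrite ler_nat finNzRing_gt1. Qed.

Let qm1 : (#|F|.-1)%:R = q - 1 :> R.
Proof. by rewrite /q -[in RHS](prednK (ltnW (finNzRing_gt1 F))) -natr1 addrK. Qed.

(** The plane contains the [#|F| - 1] nonzero multiples of [y], and [x].  Hence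
    the weight of any exceptional pair is at most the inverse of [#|F|]. *)
Lemma card_low_coefs_ge (p : 'rV[F]_n * 'rV[F]_n) (d : nat) :
  p \in low_pairs d -> (#|F| <= #|low_coefs d p.1 p.2|)%N.
Proof.
case: p => x y; rewrite inE /= => /and3P[fxy lx ly].
rewrite card_low_coefs //.
move: fxy; rewrite free_cons span_seq1 seq1_free => /andP[xy y0].
have x0 : x != 0 by apply: contraNneq xy => ->; rewrite mem0v.
have -> : #|F| = #|x |: low_vectors d <[y]>%VS|.
  rewrite cardsU1 inE (negPf xy) /= card_low_line // add1n prednK //.
  exact: ltnW (finNzRing_gt1 F).
apply: subset_leq_card; apply/subsetP => v /setU1P[->|].
  by rewrite inE x0 lx memv_span // mem_head.
rewrite !inE => /and3P[/vlineP[c ->] -> ->]; rewrite andbT.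
by rewrite memvZ // memv_span // !inE eqxx orbT.
Qed.

Lemma low_pairs_zeros (p : 'rV[F]_n * 'rV[F]_n) :
  p \in low_pairs (n - 2) =
  [&& free [:: p.1; p.2], (2 <= #|zeros p.1|)%N & (2 <= #|zeros p.2|)%N].
Proof. by rewrite inE !low_weight_zeros. Qed.

Definition zero_type P Q : {set 'rV[F]_n * 'rV[F]_n} :=
  [set p | (zeros p.1 == P) && (zeros p.2 == Q)].

Lemma card_zero_type P Q :
  #|zero_type P Q| = (#|F|.-1 ^ ((n - #|P|) + (n - #|Q|)))%N.
Proof.
rewrite expnD -!card_zeros -cardsX; apply: eq_card => p.
by rewrite !inE.
Qed.

Definition inv_low (p : 'rV[F]_n * 'rV[F]_n) : R :=
  (#|low_coefs (n - 2) p.1 p.2|%:R)^-1.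

Definition type_sum P Q : R :=
  \sum_(p in low_pairs (n - 2) :&: zero_type P Q) inv_low p.

Lemma inv_low_ge0 p : 0 <= inv_low p.
Proof. by rewrite invr_ge0. Qed.

Lemma inv_low_le p : p \in low_pairs (n - 2) -> inv_low p <= q^-1.
Proof.
move=> pl; rewrite lef_pV2 ?posrE ?ltr0n ?ler_nat.
- exact: card_low_coefs_ge.
- exact: leq_trans (ltnW (finNzRing_gt1 F)) (card_low_coefs_ge _ _ pl).
- exact: ltnW (finNzRing_gt1 F).
Qed.

Lemma type_sum_ge0 P Q : 0 <= type_sum P Q.
Proof. by apply: sumr_ge0 => p _; exact: inv_low_ge0. Qed.

Lemma type_sum_le P Q (c : R) : 0 <= c ->
  {in low_pairs (n - 2) :&: zero_type P Q, forall p, inv_low p <= c} ->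
  type_sum P Q <= c * (q - 1) ^+ ((n - #|P|) + (n - #|Q|)).
Proof.
move=> c0 h.
apply: (@le_trans _ _ (\sum_(p in low_pairs (n - 2) :&: zero_type P Q) c)).
  by apply: ler_sum => p; exact: h.
rewrite sumr_const -mulr_natr.
rewrite ler_wpM2l // -qm1 -natrX ler_nat -card_zero_type.
by rewrite subset_leq_card // subsetIr.
Qed.

(** A third zero in [x] or [y] costs one power of [#|F|]. *)
Lemma type_sum_small P Q : (2 <= #|P|)%N -> (2 <= #|Q|)%N ->
  (5 <= #|P| + #|Q|)%N -> type_sum P Q <= q ^+ (2 * n - 6).
Proof.
have q2 := q_ge2.
move=> cP cQ cPQ; apply: (@le_trans _ _ (q^-1 * (q - 1) ^+ ((n - #|P|) + (n - #|Q|)))).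
  apply: type_sum_le; first by rewrite invr_ge0; lra.
  by move=> p /setIP[pl _]; exact: inv_low_le.
rewrite ler_pdivrMl; last by lra.
rewrite -exprS; apply: (@le_trans _ _ (q ^+ ((n - #|P|) + (n - #|Q|)))).
  by apply: lerXn2r; rewrite ?nnegrE; lra.
by rewrite ler_weXn2l //; [lra | lia].
Qed.

(** If [x] and [y] vanish at the same two coordinates then so does the whole
    plane, and its [#|F| ^ 2 - 1] nonzero vectors make each weight small. *)
Lemma type_sum_same P : #|P| = 2%N -> type_sum P P <= q ^+ (2 * n - 6).
Proof.
have q2 := q_ge2.
move=> cP; have qq : 0 < q ^+ 2 - 1 by rewrite expr2; nra.
apply: (@le_trans _ _ ((q ^+ 2 - 1)^-1 * (q - 1) ^+ ((n - #|P|) + (n - #|P|)))).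
  apply: type_sum_le; first by rewrite invr_ge0 ltW.
  move=> p /setIP[_]; rewrite inE => /andP[/eqP p1 /eqP p2].
  rewrite /inv_low card_low_coefs_same ?p1 ?p2 ?cP //.
  by rewrite natrB ?expn_gt0 ?(ltnW (finNzRing_gt1 F)) // natrX.
rewrite ler_pdivrMl // cP.
have -> : (n - 2 + (n - 2) = (2 * n - 6).+2)%N by lia.
have e1 : (q - 1) ^+ (2 * n - 6).+2 <= (q - 1) ^+ 2 * q ^+ (2 * n - 6).
  rewrite -addn2 exprD mulrC ler_wpM2l ?sqr_ge0 //.
  by apply: lerXn2r; rewrite ?nnegrE; lra.
apply: (le_trans e1); rewrite ler_wpM2r ?exprn_ge0 //.
by rewrite !expr2; nra.
Qed.

(** Proportional nonzero vectors have the same zeros. *)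
Lemma zero_type_low P Q : #|P| = 2%N -> #|Q| = 2%N -> P != Q ->
  zero_type P Q \subset low_pairs (n - 2).
Proof.
move=> cP cQ PQ; apply/subsetP => -[x y]; rewrite inE /= => /andP[/eqP zx /eqP zy].
rewrite low_pairs_zeros /= zx zy cP cQ !andbT free_cons span_seq1 seq1_free.
have zero0 : zeros (0 : 'rV[F]_n) = [set: 'I_n].
  by apply/setP => j; rewrite !inE mxE eqxx.
have y0 : y != 0.
  apply: contraTneq n4 => y0; move: cQ; rewrite -zy y0 zero0 cardsT card_ord; lia.
rewrite y0 andbT; apply/vlineP => -[c e].
have [c0|c0] := eqVneq c 0.
  move: cP; rewrite -zx e c0 scale0r zero0 cardsT card_ord; lia.
case/eqP: PQ; rewrite -zx -zy e; apply/setP => j.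
by rewrite !inE mxE mulf_eq0 (negPf c0).
Qed.

(** If generic pairs have exactly [e * (#|F| - 1)] low-weight combinations, the
    sum is that of the constant [1 / (e * (#|F| - 1))], up to the contribution
    of the nongeneric pairs, and there are [(#|F| - 1) ^ (2 * n - 4)] pairs. *)
Lemma type_sum_main P Q (e : nat) : #|P| = 2%N -> #|Q| = 2%N -> P != Q ->
  (2 <= e)%N ->
  {in zero_type P Q, forall p, generic P Q p.1 p.2 ->
     #|low_coefs (n - 2) p.1 p.2| = (e * #|F|.-1)%N} ->
  `|type_sum P Q - e%:R^-1 * q ^+ (2 * n - 5)| <= (n ^ 2 + 2 * n)%:R * q ^+ (2 * n - 6).
Proof.
have q2 := q_ge2.
move=> cP cQ PQ e2 gen.
have e2' : 2 <= e%:R :> R by rewrite ler_nat.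
pose g : R := (e%:R * (q - 1))^-1.
have g0 : 0 <= g by rewrite invr_ge0 mulr_ge0 //; lra.
have gq : g <= q^-1 by rewrite lef_pV2 ?posrE; nra.
have sub := zero_type_low _ _ cP cQ PQ.
have -> : type_sum P Q = \sum_(p in zero_type P Q) inv_low p.
  by apply: eq_bigl => p; rewrite (setIidPr sub).
have main : \sum_(p in zero_type P Q) g = e%:R^-1 * (q - 1) ^+ (2 * n - 5).
  rewrite sumr_const card_zero_type cP cQ -[LHS]mulr_natl natrX qm1.
  have -> : (n - 2 + (n - 2) = (2 * n - 5).+1)%N by lia.
  rewrite exprS /g; field; apply/andP; split; lra.
have err : `|\sum_(p in zero_type P Q) inv_low p - \sum_(p in zero_type P Q) g|
    <= (n ^ 2)%:R * q ^+ (2 * n - 6).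
  rewrite -sumrB (bigID (fun p => generic P Q p.1 p.2)) /= big1 ?add0r; last first.
    move=> p /andP[pz gp]; rewrite /inv_low gen // natrM qm1 /g.
    by rewrite subrr.
  apply: (le_trans (ler_norm_sum _ _ _)).
  apply: (@le_trans _ _ (\sum_(p in zero_type P Q | ~~ generic P Q p.1 p.2) q^-1)).
    apply: ler_sum => p /andP[pz _].
    have := inv_low_le _ (subsetP sub _ pz); have := inv_low_ge0 p.
    by rewrite ler_norml; lra.
  rewrite (eq_bigl [in [set p : 'rV[F]_n * 'rV[F]_n |
       [&& zeros p.1 == P, zeros p.2 == Q & ~~ generic P Q p.1 p.2]]]); last first.
    by move=> p; rewrite !inE -andbA.
  rewrite sumr_const -[leLHS]mulr_natr ler_pdivrMl; last by lra.
  rewrite mulrCA -exprS.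
  have -> : ((2 * n - 6).+1 = 2 * n - 5)%N by lia.
  by rewrite -natrX -natrM ler_nat card_nongeneric.
rewrite main in err.
have := @expr_pred_gap R q (2 * n - 6); have -> : 1 <= q by lra.
have -> : ((2 * n - 6).+1 = 2 * n - 5)%N by lia.
move=> /(_ isT) /andP[gap0 gap1].
have gap2 : (2 * n - 5)%:R * q ^+ (2 * n - 6) <= (2 * n)%:R * q ^+ (2 * n - 6).
  by rewrite ler_wpM2r ?exprn_ge0 ?ler_nat //; lia.
have ei : 0 <= (e%:R^-1 : R) <= 1.
  by rewrite invr_ge0 ler0n invf_le1 ?ltr0n; [lra|lia].
have : `|e%:R^-1 * (q - 1) ^+ (2 * n - 5) - e%:R^-1 * q ^+ (2 * n - 5)|
     <= (2 * n)%:R * q ^+ (2 * n - 6).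
  rewrite -mulrBr normrM distrC (ger0_norm gap0) ger0_norm; last by case/andP: ei.
  apply: le_trans (le_trans gap1 gap2); case/andP: ei => _ ei.
  by rewrite ler_piMl.
move=> h; rewrite natrD mulrDl; apply: le_trans (lerD err h).
by rewrite (le_trans _ (ler_normD _ _)) // addrA subrK.
Qed.

(** The coefficient of [q ^+ (2 * n - 5)] in [type_sum P Q]: the inverse of the
    number of low-weight lines in a generic plane of type [(P, Q)], or zero for
    the types with too few pairs or with too many lines per plane. *)
Definition type_weight P Q : R :=
  if (#|P| == 2%N) && (#|Q| == 2%N) then
    if #|P :&: Q| == 0%N then 2^-1
    else if #|P :&: Q| == 1%N then (n.-1)%:R^-1 else 0
  else 0.

Lemma type_sum_estimate P Q : (2 <= #|P|)%N -> (2 <= #|Q|)%N ->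
  `|type_sum P Q - type_weight P Q * q ^+ (2 * n - 5)|
    <= (n ^ 2 + 2 * n)%:R * q ^+ (2 * n - 6).
Proof.
have q2 := q_ge2.
move=> cP cQ.
have small : type_sum P Q <= q ^+ (2 * n - 6) ->
    `|type_sum P Q - 0 * q ^+ (2 * n - 5)| <= (n ^ 2 + 2 * n)%:R * q ^+ (2 * n - 6).
  move=> h; rewrite mul0r subr0 ger0_norm ?type_sum_ge0 // (le_trans h) //.
  by rewrite ler_peMl ?exprn_ge0 ?ler1n //; nia.
rewrite /type_weight; case: ifP => [/andP[/eqP P2 /eqP Q2]|PQ]; last first.
  apply: small; apply: type_sum_small => //; lia.
case: ifP => [I0|I0].
  have PQI : P :&: Q = set0 by apply/eqP; rewrite -cards_eq0.
  have PQ : P != Q by apply/eqP => e; move: I0; rewrite e setIid Q2.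
  apply: (@type_sum_main P Q 2) => // -[x y]; rewrite inE /= => /andP[/eqP zx /eqP zy] gp.
  by apply: card_low_coefs_disjoint; rewrite // ?zx ?zy.
case: ifP => [/eqP I1|I1].
  have PQ : P != Q by apply/eqP => e; move: I1; rewrite e setIid Q2.
  apply: (@type_sum_main P Q n.-1) => //; first lia.
  move=> -[x y]; rewrite inE /= => /andP[/eqP zx /eqP zy] gp.
  by apply: card_low_coefs_meet; rewrite // ?zx ?zy.
apply: small; have -> : Q = P; last exact: type_sum_same.
have le2 : (2 <= #|P :&: Q|)%N by lia.
have eP : P :&: Q = P by apply/eqP; rewrite eqEcard subsetIl P2.
have eQ : P :&: Q = Q by apply/eqP; rewrite eqEcard subsetIr Q2.
by rewrite -eQ eP.
Qed.

(** The two-element sets [Q] split into those disjoint from [P], those meeting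
    [P] in one point, and [P] itself. *)
Lemma type_weight_sum_right P : #|P| = 2%N ->
  \sum_(Q : {set 'I_n} | (2 <= #|Q|)%N) type_weight P Q
   = 2^-1 * 'C(n - 2, 2)%:R + (n.-1)%:R^-1 * ('C(n, 2)%:R - 1 - 'C(n - 2, 2)%:R).
Proof.
move=> P2.
pose A0 := [set Q : {set 'I_n} | Q \subset ~: P & #|Q| == 2%N].
pose A1 := [set Q : {set 'I_n} | (#|Q| == 2%N) && (#|P :&: Q| == 1%N)].
pose A := [set Q : {set 'I_n} | #|Q| == 2%N].
have c0 : #|A0| = 'C(n - 2, 2) by rewrite cards_draws cardsC_ord P2.
have cA : #|A| = 'C(n, 2) by rewrite card_draws card_ord.
have dis Q : (Q \subset ~: P) = (#|P :&: Q| == 0%N).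
  by rewrite cards_eq0 setI_eq0 disjoint_sym disjoints_subset.
have c1 : (#|A1| + 1 + #|A0| = 'C(n, 2))%N.
  have defA : A = A0 :|: (P |: A1).
    apply/setP => Q; rewrite !inE dis.
    have [Q2|Q2] := eqVneq #|Q| 2%N; last first.
      by rewrite !andbF /= orbF; symmetry; apply: contraNF Q2 => /eqP->; rewrite P2.
    rewrite andbT /=; symmetry.
    have le2 : (#|P :&: Q| <= 2)%N by rewrite -P2 subset_leq_card // subsetIl.
    case E : #|P :&: Q| le2 => [|[|[|]]] //= _; rewrite ?orbT // orbF.
    apply/eqP; have eP : P :&: Q = P by apply/eqP; rewrite eqEcard subsetIl P2 E.
    have eQ : P :&: Q = Q by apply/eqP; rewrite eqEcard subsetIr Q2 E.
    by rewrite -eQ eP.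
  rewrite -cA defA cardsU cardsU1 inE setIid P2 /=.
  rewrite (_ : A0 :&: (P |: A1) = set0) ?cards0; first lia.
  apply/setP => Q; rewrite !inE dis; case: (eqVneq Q P) => [->|_] /=.
    by rewrite setIid P2.
  by case: (#|P :&: Q|) => [|[|m]]; rewrite ?andbF.
have cA1 : #|A1|%:R = 'C(n, 2)%:R - 1 - 'C(n - 2, 2)%:R :> R.
  by rewrite -c1 c0 !natrD; ring.
rewrite -cA1 -c0 !mulr_natr -!sumr_const (big_mkcond [in A0]) (big_mkcond [in A1]).
rewrite -big_split big_mkcond /=; apply: eq_bigr => Q _.
rewrite /type_weight !inE dis P2 eqxx /=.
have [Q2|] := eqVneq #|Q| 2%N; last by rewrite !andbF /= addr0; case: ifP.
rewrite Q2 andbT /=; case: (#|P :&: Q|) => [|[|m]] /=; rewrite ?addr0 ?add0r //.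
Qed.

Lemma type_weight_sum :
  \sum_(P : {set 'I_n} | (2 <= #|P|)%N)
    \sum_(Q : {set 'I_n} | (2 <= #|Q|)%N) type_weight P Q
  = whitney2_lead R n.
Proof.
rewrite /whitney2_lead.
have bin2R k : 'C(k.+1, 2)%:R = (k.+1)%:R * k%:R / 2 :> R.
  have := bin_ffact k.+1 2; rewrite ffactnS ffactn1 /= => /(congr1 (fun m => m%:R : R)).
  by rewrite !natrM => <-; field.
rewrite (bigID (fun P : {set 'I_n} => #|P| == 2%N)) /= [X in _ + X]big1 ?addr0; last first.
  by move=> P /andP[_ /negPf P2]; apply: big1 => Q _; rewrite /type_weight P2.
rewrite (eq_bigl (fun P : {set 'I_n} => P \in [set P : {set 'I_n} | #|P| == 2%N])); last first.
  by move=> P; rewrite inE; case: eqP => [->|]; rewrite ?andbF.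
rewrite (eq_bigr (fun=> 2^-1 * 'C(n - 2, 2)%:R
   + (n.-1)%:R^-1 * ('C(n, 2)%:R - 1 - 'C(n - 2, 2)%:R))); last first.
  by move=> P; rewrite inE => /eqP; exact: type_weight_sum_right.
rewrite sumr_const card_draws card_ord -[LHS]mulr_natr.
have [m ->] : exists m, n = m.+4 by exists (n - 4)%N; lia.
have -> : (m.+4 - 2 = m.+2)%N by lia.
have m3 : m%:R + 3 != 0 :> R by rewrite -natrD pnatr_eq0 addn3.
rewrite !bin2R /= -(addn4 m) -(addn3 m) -(addn2 m) -(addn1 m) !natrD. field.
exact: m3.
Qed.

Lemma whitney2_estimate :
  `|(q - 1) * (dowling_whitney F n (n - 2) 2)%:~R
    - whitney2_lead R n * q ^+ (2 * n - 5)|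
  <= (2 ^ n * 2 ^ n * (n ^ 2 + 2 * n))%:R * q ^+ (2 * n - 6).
Proof.
have q2 := q_ge2.
rewrite -qm1 whitney2_sum -type_weight_sum.
rewrite (partition_big (fun p => (zeros p.1, zeros p.2))
  (fun PQ : {set 'I_n} * {set 'I_n} => (2 <= #|PQ.1|)%N && (2 <= #|PQ.2|)%N)) /=; last first.
  by move=> p; rewrite low_pairs_zeros => /and3P[_ -> ->].
rewrite pair_big /= big_distrl /= -sumrB.
apply: (le_trans (ler_norm_sum _ _ _)).
apply: (@le_trans _ _ (\sum_(PQ : {set 'I_n} * {set 'I_n})
    (n ^ 2 + 2 * n)%:R * q ^+ (2 * n - 6))).
  rewrite big_mkcond; apply: ler_sum => -[P Q] _ /=; case: ifP => [/andP[cP cQ]|_].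
    have := type_sum_estimate P Q cP cQ; congr (`| _ - _ | <= _).
    by apply: eq_bigl => p; rewrite !inE.
  by rewrite mulr_ge0 // exprn_ge0 //; lra.
have cS : #|{: {set 'I_n}}| = (2 ^ n)%N.
  by rewrite -cardsT -powersetT card_powerset cardsT card_ord.
by rewrite sumr_const card_prod cS -[leLHS]mulr_natl mulrA -natrM.
Qed.

End ZeroTypes.

(** * Asymptotics over the prime powers *)

From mathcomp Require Import boolp classical_sets functions reals topology normedtype.
From mathcomp Require Import landau.

Import Order.TTheory GRing.Theory Num.Theory.
Import numFieldNormedType.Exports.
Local Open Scope classical_set_scope.
Local Open Scope ring_scope.

Lemma whitney2_lead_gt0 (R : realFieldType) (n : nat) :
  (4 <= n)%N -> 0 < whitney2_lead R n.
Proof.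
move=> n4; rewrite /whitney2_lead.
have [m ->] : exists m, n = (m + 4)%N by exists (n - 4)%N; lia.
have m0 : 0 <= m%:R :> R by [].
rewrite natrD; set t := m%:R in m0 *.
have -> : 1 / 8 * (t + 4) ^+ 4 - 3 / 4 * (t + 4) ^+ 3 + 19 / 8 * (t + 4) ^+ 2
    - 11 / 4 * (t + 4)
  = 1 / 8 * t ^+ 4 + 5 / 4 * t ^+ 3 + 43 / 8 * t ^+ 2 + 49 / 4 * t + 11 by field.
have := exprn_ge0 4 m0; have := exprn_ge0 3 m0; have := exprn_ge0 2 m0; lra.
Qed.

(** Replacing [q ^+ (2 * n - 5)] by [(q - 1) * q ^+ (2 * n - 6)] in the estimate
    costs one more term of the order of the error. *)
Lemma whitney2_error (R : realFieldType) (n : nat) : (4 <= n)%N ->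
  exists K : R, forall q, prime_powers q ->
    (q%:R - 1) * `|(whitney q n (n - 2) 2)%:~R - whitney2_lead R n * q%:R ^+ (2 * n - 6)|
      <= K * q%:R ^+ (2 * n - 6).
Proof.
move=> n4; exists ((2 ^ n * 2 ^ n * (n ^ 2 + 2 * n))%:R + whitney2_lead R n) => q qpp.
have := whitney2_estimate R (GF q) n n4; rewrite -/(whitney q n (n - 2) 2).
rewrite card_GF //.
have q1 : 0 <= q%:R - 1 :> R.
  rewrite subr_ge0 ler1n -(card_GF qpp); exact: ltnW (finNzRing_gt1 _).
have c0 := whitney2_lead_gt0 R n n4.
have -> : (2 * n - 5 = (2 * n - 6).+1)%N by lia.
set w := _%:~R; set c := whitney2_lead R n; set M := q%:R ^+ (2 * n - 6) => h.
have M0 : 0 <= M by rewrite exprn_ge0.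
rewrite -[X in X * `|_|]ger0_norm // -normrM [leRHS]mulrDl.
have -> : (q%:R - 1) * (w - c * M)
   = ((q%:R - 1) * w - c * q%:R ^+ (2 * n - 6).+1) + c * M.
  by rewrite exprS /M; ring.
apply: le_trans (ler_normD _ _) _; apply: lerD => //.
by rewrite ger0_norm // mulr_ge0 // ltW.
Qed.

(** An error smaller than the main term by a factor [q - 1] is eventually below
    any multiple of it. *)
Lemma near_prime_powers_le (R : realType) (w : nat -> R) (c K : R) (k : nat) :
  (forall q, prime_powers q -> (q%:R - 1) * `|w q - c * q%:R ^+ k| <= K * q%:R ^+ k) ->
  forall eps, 0 < eps ->
  \forall q \near within prime_powers \oo, `|w q - c * q%:R ^+ k| <= eps * q%:R ^+ k.
Proof.
move=> h eps e0; rewrite near_withinE; near=> q => qpp.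
have q1 : 1 + K / eps <= q%:R by near: q; exact: nbhs_infty_ger.
have q2 : 2%:R <= q%:R :> R by near: q; exact: nbhs_infty_ger.
have q10 : 0 < q%:R - 1 :> R by lra.
rewrite -(ler_pM2l q10); apply: le_trans (h q qpp) _.
rewrite mulrA ler_wpM2r ?exprn_ge0 //.
by rewrite -ler_pdivrMr //; lra.
Unshelve. all: by end_near. Qed.

Theorem theorem10p5 (R : realType) (n : nat) (hn : (4 <= n)%N) :
  [/\ (fun q : nat => (whitney q n (n - 2) 2)%:~R : R^o)
        ~_(within prime_powers \oo)
      (fun q : nat =>
         (1 / 8 * n%:R ^+ 4 - 3 / 4 * n%:R ^+ 3
          + 19 / 8 * n%:R ^+ 2 - 11 / 4 * n%:R) * q%:R ^+ (2 * n - 6) : R^o),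
      (fun q : nat => `|(whitney q n (n - 2) 2)%:~R : R| : R^o)
        \is 'Theta_(within prime_powers \oo)
      (fun q : nat =>
         q%:R ^+ ((n - 2) - 1 + n * (2 - 1) - 'C(2 + 1, 2)) : R^o)
    & ((n - 2) - 1 + n * (2 - 1) - 'C(2 + 1, 2) = 2 * n - 6)%N].
Proof.
have exponent : ((n - 2) - 1 + n * (2 - 1) - 'C(2 + 1, 2) = 2 * n - 6)%N.
  have -> : 'C(2 + 1, 2) = 3%N by [].
  lia.
have c0 := whitney2_lead_gt0 R n hn.
have [K hK] := whitney2_error R n hn.
have close := near_prime_powers_le _ _ _ _ _ hK.
rewrite exponent; split=> //.
  apply/eqaddoP => eps e0.
  have := close (eps * whitney2_lead R n) (mulr_gt0 e0 c0).
  apply: filterS => q /le_trans; apply; rewrite -[leLHS]mulrA.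
  by apply: ler_wpM2l; [exact: ltW | exact: (@ler_norm R)].
rewrite qualifE; apply/asboolP.
(* within half of the leading term, hence between [c / 2] and [2 * c] *)
pose c := whitney2_lead R n.
exists (c / 2, c * 2) => /=; first by rewrite divr_gt0 ?mulr_gt0.
have := close (c / 2) (divr_gt0 c0 (ltr0Sn _ 1)).
apply: filterS => q h.
have := exprn_ge0 (2 * n - 6) (ler0n R q).
move: h; rewrite normr_id; set M := q%:R ^+ _; set w := _%:~R.
rewrite -/c ler_norml => /andP[lo hi] M0; rewrite !(ger0_norm M0).
have cM0 : 0 <= c * M by rewrite mulr_ge0 // ltW.
have w0 : 0 <= w by lra.
by rewrite (ger0_norm w0); split; lra.
Qed.
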